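(* Let $r=\frac{p}{q}\in(0,1]$ with $p,q$ coprime positive integers, and let $X_n\subseteq S^1$ be a set of $n$ points chosen independently and uniformly at random from $S^1$. Then asymptotically almost surely (i.e. with probability tending to $1$ as $n\to\infty$) the map $f_r\colon X_n\to X_n$ has a single periodic orbit, and its winding number $w_n$ and length $\ell_n$ satisfy $\ell_n p-w_n q=1$.
   Context: $S^1=\mathbb{R}/\mathbb{Z}$ is the circle of unit circumference with the arc-length metric; $\vec{d}(x,y)$ is the clockwise distance from $x$ to $y$ and $[x,y)_{S^1}$ the half-open clockwise arc. For finite $X\subseteq S^1$ and $0<r\le1$, $f_r\colon X\to X$ sends $x$ to the element of $X\cap[x,x+r)_{S^1}$ clockwise furthest from $x$. A point $x$ is periodic if $f_r^i(x)=x$ for some $i\ge1$; its periodic orbit $\{f_r^i(x): i\ge 0\}$ has length $\ell$ equal to the least $i\ge1$ with $f_r^i(x)=x$. The winding number of a sequence $x_1,\dots,x_s\in S^1$ is $\mathrm{wn}(x_1,\dots,x_s)=\sum_{i=1}^s\vec{d}(x_i,x_{i+1})$ with $x_{s+1}=x_1$; the winding number of the periodic orbit of $x$ is $\mathrm{wn}(x,f_r(x),\dots,f_r^{\ell-1}(x))$. *)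

(* Defs.v *)
From HB Require Import structures.
From mathcomp Require Import all_boot all_order all_algebra.
From mathcomp Require Import finmap generic_quotient.
From mathcomp Require Import all_classical all_reals all_analysis.

Set Implicit Arguments.
Unset Strict Implicit.
Unset Printing Implicit Defensive.

Import Order.TTheory GRing.Theory Num.Theory.
Import numFieldNormedType.Exports.

Local Open Scope classical_set_scope.
Local Open Scope ring_scope.
Local Open Scope quotient_scope.

Section circle.
Variable R : realType.

Definition eqmodZ : rel R := fun a b => b - a \is a Num.int.

Lemma eqmodZ_equiv : equiv_class_of eqmodZ.
Proof.
rewrite /eqmodZ; split=> [a|a b|b a c ab bc].
- by rewrite subrr rpred0.
- by rewrite -opprB rpredN.
- by rewrite -(subrKA b) rpredD.
Qed.

Canonical eqmodZ_canonical := EquivRelPack eqmodZ_equiv.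

(* S^1 = R / Z, with the quotient topology and its Borel sigma-algebra. *)
Definition circle : Type := quotient_topology {eq_quot eqmodZ}.

HB.instance Definition _ := Topological.copy circle
  (quotient_topology {eq_quot eqmodZ}).
HB.instance Definition _ := Quotient.copy circle
  (quotient_topology {eq_quot eqmodZ}).
HB.instance Definition _ := isPointed.Build circle (\pi_circle (0 : R)).

Definition circle_display : measure_display := sigma_display (@open circle).

HB.instance Definition _ := @isMeasurable.Build circle_display circle
  <<s open >> (@sigma_algebra0 _ setT open) (@sigma_algebraC _ open)
  (@sigma_algebra_bigcup _ setT open).

(* Normalised arc length: the image under R -> R/Z of the uniform
   distribution on [0, 1]. *)
Definition circle_uniform : set circle -> \bar R :=
  pushforward (uniform_prob (@ltr01 R)) \pi_circle.

(* "Clockwise" is the direction of increasing real representatives: the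
   distance is the fractional part of the difference of representatives. *)
Definition cdist (x y : circle) : R :=
  let t := repr y - repr x in t - (Num.floor t)%:~R.

Lemma cdist_pi (a b : R) :
  cdist (\pi_circle a) (\pi_circle b) = (b - a) - (Num.floor (b - a))%:~R.
Proof.
have h (c : R) : exists m : int, repr (\pi_circle c) = c + m%:~R.
  have /eqP : \pi_{eq_quot eqmodZ} c =
      \pi_{eq_quot eqmodZ} (repr (\pi_circle c)).
    by rewrite -[LHS]reprK.
  rewrite eqmodE => /intrP[m hm].
  by exists m; rewrite -hm addrC subrK.
have [m hm] := h a; have [k hk] := h b.
rewrite /cdist hm hk.
have -> : b + k%:~R - (a + m%:~R) = (b - a) + (k - m)%:~R.
  by rewrite intrD rmorphN/= opprD addrACA.
rewrite floorDrz ?intr_int// intrKfloor [in X in _ - X]intrD.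
by rewrite [X in _ - X]addrC opprD addrA addrK.
Qed.

(* The arc [x, x + r)_{S^1}, for 0 < r <= 1; it is the whole circle if
   r = 1. *)
Definition arc (x : circle) (r : R) : {pred circle} :=
  [pred y | cdist x y < r].

Definition furthest (r : R) (X : {fset circle}) (x : X) : X :=
  [arg max_(y > x | val y \in arc (val x) r) cdist (val x) (val y)]%O.

Definition winding_number (s : seq circle) : R :=
  \sum_(xy <- zip s (rot 1 s)) cdist xy.1 xy.2.

End circle.

Section periodic.
Variables (T : Type) (f : T -> T).

Definition periodic (x : T) : Prop := exists2 i, (1 <= i)%N & iter i f x = x.

Definition forward_orbit (x : T) : set T := [set iter i f x | i in setT].

Definition single_periodic_orbit : Prop :=
  exists! O : set T, exists2 x, periodic x & O = forward_orbit x.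

Definition orbit_length (x : T) (l : nat) : Prop :=
  [/\ (1 <= l)%N, iter l f x = x
    & forall i, (1 <= i)%N -> iter i f x = x -> (l <= i)%N].

End periodic.

Definition mutually_independent d d' (T : measurableType d)
    (T' : measurableType d') (R : realType) (P : probability T R)
    (I : finType) (U : I -> {RV P >-> T'}) : Prop :=
  forall (J : {set I}) (A : I -> set T'), (forall i, measurable (A i)) ->
    P (\bigcap_(i in [set` J]) (U i @^-1` A i)) =
    (\prod_(i in J) P (U i @^-1` A i))%E.

Definition random_points d (T : measurableType d) (R : realType)
    (P : probability T R) (n : nat) (U : 'I_n -> {RV P >-> circle R}) (w : T) :
    {fset circle R} :=
  [fset U i w | i in 'I_n]%fset.

(* Main.v *)
(* Lift an orbit to a real sequence a(0) <= a(1) <= ... and pass to the rotating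
   frame u(m) = a(m) - m p/q. As f_r moves by less than r = p/q, u is strictly
   decreasing, and modulo 1/q its points are those of X, each coloured by the
   sector [k/q, (k+1)/q) containing it; f_r goes to the next point, in
   decreasing order of the position inside the sector, whose colour is the
   current one plus p.

   Call q points consecutive for this order a good window if their colours are
   0, p, 2p, ..., (q-1)p modulo q. A trajectory cannot jump over a good window,
   since the colour it waits for occurs there; once at the j-th point of the
   window it goes on to the (j+1)-st one, so it reaches the last one. Hence the
   last point z of a good window lies on every orbit, so there is one periodic
   orbit, and u meets z at each level modulo 1/q: two successive visits differ
   by 1/q in u. So the total drop (l p - w q)/q over a period is 1/q.

   Given the order of the positions, the colours are independent and uniform,
   so the n/q disjoint windows are all bad with probability
   (1 - q^-q)^(n/q) -> 0. To use independence for product events only, the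
   circle is cut into q L equal cells with L = (n+1)^3: the positions are then
   distinct up to probability n^2/L, and one counts colourings of cells. *)
Require Import Defs.
From HB Require Import structures.
From mathcomp Require Import all_boot all_order all_algebra.
From mathcomp Require Import finmap generic_quotient.
From mathcomp Require Import all_classical all_reals all_analysis.
From mathcomp Require Import measurable_realfun.
From mathcomp Require Import ring lra zify.
Import Order.TTheory GRing.Theory Num.Theory.
Import numFieldNormedType.Exports.
Local Open Scope ring_scope.

(** * Counting the colourings of cells that have no good window *)

Section cells.
Context {n q L p : nat}.
Hypothesis q_gt0 : (0 < q)%N.
Local Notation cells := {ffun 'I_n -> 'I_q * 'I_L}.
Implicit Types (c : cells) (s : 'I_n -> 'I_L) (i : 'I_n) (k : nat).

Definition pos c i : 'I_L := (c i).2.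

(** Counted from the highest position because the rotating frame moves downwards; for injective [s]
    the ranks are exactly 0, ..., n - 1. *)
Definition desc_rank s i : nat := #|[set i' | (s i < s i')%N]|.

Lemma desc_rank_lt s i : (desc_rank s i < n)%N.
Proof.
rewrite -[ltnRHS]card_ord; apply: proper_card; rewrite properE; apply/andP.
by split; [apply/fintype.subsetP | apply/fintype.subsetPn; exists i; rewrite ?inE// ltnn].
Qed.

Lemma desc_rank_anti s i i' : (s i < s i')%N -> (desc_rank s i' < desc_rank s i)%N.
Proof.
move=> ii'; apply: proper_card; rewrite properE; apply/andP; split.
  by apply/fintype.subsetP => j; rewrite !inE; exact: ltn_trans.
by apply/fintype.subsetPn; exists i'; rewrite !inE ?ltnn.
Qed.

Lemma desc_rank_inj s : injective s -> injective (desc_rank s).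
Proof.
move=> s_inj i i' ii'; apply/s_inj/val_inj => /=.
by case: (ltngtP (s i) (s i')) => // /desc_rank_anti; rewrite ii' ltnn.
Qed.

Lemma desc_rank_surj s k : injective s -> (k < n)%N -> exists i, desc_rank s i = k.
Proof.
move=> s_inj kn; pose g i := Ordinal (desc_rank_lt s i).
have g_inj : injective g by move=> i i' [] /(desc_rank_inj _ s_inj).
have [h _ hK] := injF_bij g_inj.
by exists (h (Ordinal kn)); have /(congr1 val) := hK (Ordinal kn).
Qed.

(* The sector prescribed for the point of index k in a window. *)
Definition target k : 'I_q := Ordinal (ltn_pmod (k * p) q_gt0).

(** The quotient of the rank by q numbers the disjoint windows, and the remainder is the index
    inside the window. *)
Definition good_window c k : bool :=
  [forall i, (desc_rank (pos c) i %/ q == k)%N ==>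
    ((c i).1 == target (desc_rank (pos c) i %% q))].

Definition no_good_window k : {set cells} :=
  [set c | injectiveb (pos c) & [forall j : 'I_k, ~~ good_window c j]].

Definition set_window k c : cells :=
  [ffun i => (if (desc_rank (pos c) i %/ q == k)%N
    then target (desc_rank (pos c) i %% q) else (c i).1, (c i).2)].

Lemma pos_set_window k c : pos (set_window k c) = pos c.
Proof. by apply/funext => i; rewrite /pos ffunE. Qed.

(* Overwriting the sectors of the points of window k by their targets is at
   most q^q to one. *)
Lemma card_no_good_window k : (#|no_good_window k| <=
  #|[set c in no_good_window k | good_window c k]| * q ^ q)%N.
Proof.
(* [old] records the sectors that [set_window] erases, so the pair [h c] determines [c]; [target 0]
   only fills the ranks that no point has. *)
pose old c : {ffun 'I_q -> 'I_q} := [ffun j : 'I_q =>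
  if [pick i | desc_rank (pos c) i == k * q + j]%N is Some i then (c i).1
  else target 0].
pose h c := (set_window k c, old c).
have <- : #|[set: {ffun 'I_q -> 'I_q}]| = (q ^ q)%N.
  by rewrite cardsT card_ffun !card_ord.
rewrite -cardsX.
rewrite -(card_in_imset (f := h)); last first.
  move=> c c'; rewrite !inE => /andP[/injectiveP c_inj _] _ [wE oE].
  have pE : pos c = pos c' by rewrite -(pos_set_window k) wE pos_set_window.
  apply/ffunP => i; rewrite (surjective_pairing (c i)) (surjective_pairing (c' i)).
  congr pair; last by rewrite -[(c i).2]/(pos c i) pE.
  have /(congr1 fst) := congr1 (fun g : cells => g i) wE.
  rewrite !ffunE /= -pE; case: eqP => // rk _.
  have := congr1 (fun g : {ffun 'I_q -> 'I_q} =>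
    g (Ordinal (ltn_pmod (desc_rank (pos c) i) q_gt0))) oE.
  rewrite !ffunE -pE /= -rk -divn_eq.
  case: pickP => [i' /eqP/(desc_rank_inj _ c_inj)-> //|/(_ i)].
  by rewrite eqxx.
apply/subset_leq_card/fintype.subsetP => _ /imsetP[c + ->].
rewrite !inE /= pos_set_window => /andP[-> /forallP c_bad]; rewrite andbT /=.
apply/andP; split; last first.
  apply/forallP => i; rewrite pos_set_window; apply/implyP => rk.
  by rewrite ffunE rk.
(* The other windows keep their sectors, so the earlier ones remain bad. *)
apply/forallP => j; have := c_bad j; apply: contraNN => /forallP good.
apply/forallP => i; apply/implyP => rk; have := good i.
rewrite pos_set_window rk /= ffunE /= (eqP rk).
by rewrite (ltn_eqF (ltn_ord j)).
Qed.

(** Among the colourings whose first [k] windows are bad, a share of at least q^-q has window [k]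
    good, which leaves a factor 1 - q^-q per window; denominators are cleared to stay in the
    naturals. *)
Lemma card_no_good_windows k :
  (#|no_good_window k| * (q ^ q) ^ k <= (q * L) ^ n * (q ^ q).-1 ^ k)%N.
Proof.
elim: k => [|k IHk].
  rewrite !muln1; apply: leq_trans (max_card _) _.
  by rewrite card_ffun card_prod !card_ord.
have -> : #|no_good_window k.+1| =
    (#|no_good_window k| - #|[set c in no_good_window k | good_window c k]|)%N.
  have -> : [set c in no_good_window k | good_window c k] =
      no_good_window k :&: [set c | good_window c k].
    by apply/finset.setP => c; rewrite !inE.
  rewrite -cardsD; apply: eq_card => c; rewrite !inE.
  case: injectiveb => /=; last by rewrite andbF.
  apply/forallP/andP => [bad|[ck /forallP bad] j].
    split; first exact: (bad ord_max).
    by apply/forallP => j; exact: (bad (widen_ord (leqnSn k) j)).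
  have := ltn_ord j; rewrite ltnS leq_eqVlt => /orP[/eqP->//|jk].
  exact: (bad (Ordinal jk)).
(* With D = q^q, the bound b <= g D yields (b - g) D <= b D - b = (D - 1) b. *)
have := card_no_good_window k; set b := #|_|; set g := #|_| => bg.
rewrite !expnS (mulnCA _ (q ^ q).-1) mulnA.
apply: leq_trans (_ : (q ^ q).-1 * (b * (q ^ q) ^ k) <= _)%N; last first.
  by rewrite leq_mul2l IHk orbT.
rewrite [leqRHS]mulnA leq_mul2r; apply/orP; right.
rewrite mulnBl -subn1 mulnBl mul1n (mulnC b) leq_sub2l//.
Qed.

Definition collision i j : {set cells} := [set c | pos c i == pos c j].

(* Moving point i to any of the L positions is injective on collisions. *)
Lemma card_collision i j : i != j -> (#|collision i j| * L <= (q * L) ^ n)%N.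
Proof.
move=> ij.
pose h (u : cells * 'I_L) : cells :=
  [ffun i' => if i' == i then ((u.1 i).1, u.2) else u.1 i'].
have <- : #|{: cells}| = ((q * L) ^ n)%N by rewrite card_ffun card_prod !card_ord.
rewrite -[X in (_ * X)%N]card_ord -[X in (_ * X)%N]cardsT -cardsX.
rewrite -(card_in_imset (f := h)) ?max_card//.
move=> [c t] [c' t']; rewrite !inE /= !andbT => /eqP cij /eqP cij' hE.
have E i' : h (c, t) i' = h (c', t') i' by rewrite hE.
have cj : c j = c' j by have := E j; rewrite !ffunE eq_sym (negbTE ij).
have [ci1 tt'] : (c i).1 = (c' i).1 /\ t = t'.
  by have := E i; rewrite !ffunE eqxx /= => -[-> ->].
rewrite tt'; congr pair; apply/ffunP => i'.
have [->|i'i] := eqVneq i' i; last first.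
  by have := E i'; rewrite !ffunE (negbTE i'i).
rewrite (surjective_pairing (c i)) (surjective_pairing (c' i)) ci1.
by rewrite -[(c i).2]/(pos c i) -[(c' i).2]/(pos c' i) cij cij' /pos cj.
Qed.

(** Union bound over the ordered pairs of distinct indices, at most n^2 in number. *)
Lemma card_not_injective :
  (#|[set c : cells | ~~ injectiveb (pos c)]| * L <= n ^ 2 * (q * L) ^ n)%N.
Proof.
have sub : [set c : cells | ~~ injectiveb (pos c)] \subset
    \bigcup_(u : 'I_n * 'I_n | u.1 != u.2) collision u.1 u.2.
  apply/fintype.subsetP => c; rewrite inE => /injectivePn[i [j ij cij]].
  by apply/bigcupP; exists (i, j); rewrite ?inE//; apply/eqP.
apply: leq_trans (leq_mul (subset_leq_card sub) (leqnn L)) _.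
have le_sum : (#|\bigcup_(u : 'I_n * 'I_n | u.1 != u.2) collision u.1 u.2| <=
    \sum_(u : 'I_n * 'I_n | u.1 != u.2) #|collision u.1 u.2|)%N.
  elim/big_rec2: _ => [|u A b _ Ab]; first by rewrite cards0.
  by apply: leq_trans (leq_card_setU _ _) _; rewrite leq_add2l.
apply: leq_trans (leq_mul le_sum (leqnn L)) _; rewrite big_distrl/=.
apply: (@leq_trans (\sum_(u : 'I_n * 'I_n) (q * L) ^ n)).
  rewrite [leqRHS](bigID (fun u => u.1 != u.2))/=; apply: leq_trans (leq_addr _ _).
  by apply: leq_sum => u /card_collision.
by rewrite sum_nat_const card_prod !card_ord mulnn.
Qed.

Definition bad_cells : {set cells} :=
  [set c | ~~ (injectiveb (pos c) && [exists k : 'I_(n %/ q), good_window c k])].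

(** Divided by (q L)^n L D^(n / q), where D = q^q, this bounds the proportion of bad colourings by
    n^2 / L for a collision plus (1 - 1 / D)^(n / q) for the absence of a good window. *)
Lemma card_bad_cells : (#|bad_cells| * (L * (q ^ q) ^ (n %/ q)) <=
  (q * L) ^ n * (n ^ 2 * (q ^ q) ^ (n %/ q) + L * (q ^ q).-1 ^ (n %/ q)))%N.
Proof.
have -> : bad_cells = [set c : cells | ~~ injectiveb (pos c)] :|:
    no_good_window (n %/ q).
  apply/finset.setP => c; rewrite !inE negb_and; case: injectiveb => //=.
  by rewrite negb_exists.
apply: leq_trans (leq_mul (leq_card_setU _ _) (leqnn _)) _.
rewrite mulnDl mulnDr leq_add//.
  by rewrite mulnA [leqRHS]mulnA leq_mul// mulnC [leqRHS]mulnC mulnC card_not_injective.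
by rewrite mulnCA [leqRHS]mulnCA leq_mul// card_no_good_windows.
Qed.

End cells.

(** * Trajectories on the real line that meet a good window *)

Local Open Scope classical_set_scope.

(** As p is a unit modulo q, its multiples take every colour; [k] is c times the Bezout inverse of
    p, reduced modulo q. *)
Lemma dvdz_subM_surj (p q : nat) (c : int) : (0 < q)%N -> coprime p q ->
  exists k : nat, (q %| c - k%:Z * p%:Z)%Z.
Proof.
move=> q_gt0 pq; have [u [v uv]] := Bezoutz p q.
have {}uv : u * p%:Z + v * q%:Z = 1 by rewrite uv; apply/eqP.
have q0 : q%:Z != 0 by rewrite -lt0n.
have kE := gez0_abs (modz_ge0 (c * u) q0).
exists `|((c * u) %% q)%Z|%N; apply/dvdzP.
exists (c * v + ((c * u) %/ q)%Z * p%:Z).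
have := divz_eq (c * u) q; rewrite -kE => cuE.
rewrite -{1}(mulr1 c) -uv mulrDr mulrA {1}cuE; ring.
Qed.

(* S is a set of lifts of points of the circle, z lists the positions inside the
   sectors of the points of a good window, and a is a lifted orbit. *)
Section window.
Context {R : realType} {p q : nat} {S : set R} {z : nat -> R}.
Hypotheses (q_gt0 : (0 < q)%N) (pq : coprime p q).
Hypothesis z_decr : forall j, (j.+1 < q)%N -> z j.+1 < z j.
Hypothesis S_window : forall j (e : int), (j < q)%N ->
  (q %| e - j%:Z * p%:Z)%Z -> S (z j + e%:~R / q%:R).
Hypothesis window_only : forall y (e : int), z q.-1 <= y <= z 0 ->
  S (y + e%:~R / q%:R) ->
  exists2 j, (j < q)%N & y = z j /\ (q %| e - j%:Z * p%:Z)%Z.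

Context {a : nat -> R} {eps : R}.
Hypothesis eps_gt0 : 0 < eps.
Hypothesis Sa : forall m, S (a m).
Hypothesis a_lt : forall m, a m.+1 <= a m + p%:R / q%:R - eps.
Hypothesis a_max : forall m b, S b -> b < a m + p%:R / q%:R -> b <= a m.+1.

(** The integer [c] selects the copy of the window at height c / q. It is kept free so that one
    trajectory can be followed through two successive copies, which gives the drop over a period. *)
Lemma window_hit (c : int) : z 0 + c%:~R / q%:R < a 0 ->
  exists m : nat, a m = z q.-1 + (c + m%:Z * p%:Z)%:~R / q%:R /\
    (q %| c + m%:Z * p%:Z - q.-1%:Z * p%:Z)%Z.
Proof.
(* [k0] is an index of the colour c, so the colour c + m p awaited at time m has index m + k0 modulo
   q. *)
move=> c_lt; have [k0 k0E] := dvdz_subM_surj _ _ c q_gt0 pq.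
have q0 : q%:R != 0 :> R by rewrite pnatr_eq0 -lt0n.
(* The frame is also lowered by c / q, which brings the chosen copy of the window to the heights
   given by [z]. *)
pose u m := a m - m%:R * (p%:R / q%:R) - c%:~R / q%:R.
have aE m : a m = u m + (c + m%:Z * p%:Z)%:~R / q%:R.
  by rewrite /u intrD intrM !mulrDl; ring.
have uS m : u m.+1 <= u m - eps.
  by rewrite /u; have := a_lt m; rewrite -natr1; lra.
(* z (j m) is the only point of the window which a m can be *)
pose j m := ((m + k0) %% q)%N.
have jq m : (j m < q)%N by rewrite ltn_mod.
have jE m : (q %| c + m%:Z * p%:Z - (j m)%:Z * p%:Z)%Z.
  rewrite (_ : _ - _ = (c - k0%:Z * p%:Z) + ((m + k0)%:Z - (j m)%:Z) * p%:Z).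
    by rewrite rpredD// dvdz_mulr// -eqz_mod_dvd !modz_nat modn_mod.
  by rewrite PoszD; ring.
have z_anti i k : (i <= k < q)%N -> z k <= z i.
  elim: k => [|k IHk] /andP[ik kq]; first by move: ik; rewrite leqn0 => /eqP->.
  move: ik; rewrite leq_eqVlt => /orP[/eqP->//|ik].
  by rewrite (le_trans (ltW (z_decr _ kq)))// IHk// -ltnS ik ltnW.
have zq0 i : (i < q)%N -> z q.-1 <= z i <= z 0.
  by move=> iq; rewrite !z_anti//; lia.
(* The awaited point lies below a(m) + p / q, so maximality forbids jumping over it. *)
have jS m : z (j m.+1) < u m -> z (j m.+1) <= u m.+1.
  move=> zu; have := S_window (j m.+1) (c + m.+1%:Z * p%:Z) (jq _) (jE _).
  move=> /(a_max m); rewrite (aE m.+1) lerD2r; apply.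
  rewrite aE -addrA ltr_leD// -mulrDl ler_wpM2r ?invr_ge0//.
  by rewrite !intrD !intrM -!pmulrn -natr1; lra.
have in_window m : z q.-1 <= u m <= z 0 -> u m = z (j m).
  move=> /window_only - /(_ (c + m%:Z * p%:Z)); rewrite -aE => /(_ (Sa m)).
  move=> [i iq [-> iE]]; congr (z _).
  (* Two indices below q with the same colour agree, p being a unit modulo q. *)
  have : (q %| ((j m)%:Z - i%:Z) * p%:Z)%Z.
    rewrite (_ : _ * _ = (c + m%:Z * p%:Z - i%:Z * p%:Z) -
      (c + m%:Z * p%:Z - (j m)%:Z * p%:Z)); first exact: rpredB.
    ring.
  rewrite Gauss_dvdzl; last by rewrite coprimezE/= coprime_sym.
  by rewrite -eqz_mod_dvd !modz_nat !modn_small// => /eqP[].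
have run t m : u m = z (j m) -> (j m + t = q.-1)%N ->
    exists m', u m' = z q.-1 /\ j m' = q.-1.
  elim: t m => [|t IHt] m um; first by rewrite addn0 => jm; exists m; rewrite um jm.
  rewrite addnS -addSn => jmt.
  have jmS : j m.+1 = (j m).+1.
    rewrite /j addSn -[in LHS]addn1 -modnDml addn1 modn_small//.
    by rewrite -[ltnRHS](prednK q_gt0) ltnS -jmt leq_addr.
  apply: (IHt m.+1); last by rewrite jmS.
  have zj : z (j m.+1) <= u m.+1 by apply: jS; rewrite jmS um z_decr// -jmS.
  apply: in_window; apply/andP; split.
    by apply: le_trans zj; have /andP[] := zq0 _ (jq m.+1).
  apply: le_trans (uS m) _; rewrite um; apply: (@le_trans _ _ (z (j m))).
    by rewrite gerBl ltW.
  by have /andP[] := zq0 _ (jq m).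
have ex_le : exists m, u m <= z 0.
  have u_le m : u m <= u 0 - m%:R * eps.
    elim: m => [|m IHm]; first by rewrite mul0r subr0.
    by rewrite (le_trans (uS m))// -natr1; lra.
  exists (Num.bound `|(u 0 - z 0) / eps|).
  set b := Num.bound _; apply: le_trans (u_le b) _.
  have : (u 0 - z 0) / eps < b%:R.
    exact: le_lt_trans (ler_norm _) (archi_boundP (normr_ge0 _)).
  by rewrite ltr_pdivrMr//; lra.
(* The first time at or below the top of the window is not 0, by the assumption on [c], and just
   before it the trajectory was above the whole window. *)
case: (ex_minnP ex_le) => -[|m].
  by rewrite /u mul0r subr0; lra.
move=> um m_min.
have zum : z 0 < u m by rewrite ltNge; apply/negP => /m_min; rewrite ltnn.
have zuS : z (j m.+1) <= u m.+1.
  by apply: jS; have /andP[_ /le_lt_trans->] := zq0 _ (jq m.+1).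
have uj : u m.+1 = z (j m.+1).
  apply: in_window; rewrite um andbT.
  by have /andP[/le_trans-> //] := zq0 _ (jq m.+1).
have [|m' [um' jm']] := run (q.-1 - j m.+1)%N m.+1 uj.
  by rewrite subnKC// -ltnS prednK.
exists m'; split; first by rewrite aE um'.
by have := jE m'; rewrite jm'.
Qed.
End window.

(** * Real coordinates and distances on the circle *)

Section circle_coordinates.
Context {R : realType}.
Implicit Types (a b : R) (x y : circle R).
Local Open Scope quotient_scope.

Lemma eq_pi_circle a b :
  \pi_(circle R) a = \pi_(circle R) b <-> b - a \is a Num.int.
Proof.
have -> : (b - a \is a Num.int) = (a == b %[mod {eq_quot @eqmodZ R}]).
  by rewrite eqmodE.
by split=> [ab|/eqP //]; apply/eqP; exact: ab.
Qed.

Lemma pi_circleD a (k : int) : \pi_(circle R) (a + k%:~R) = \pi_(circle R) a.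
Proof. by apply/eq_pi_circle; rewrite opprD addNKr rpredN intr_int. Qed.

Lemma cdist_itv x y : 0 <= cdist x y < 1.
Proof.
rewrite /cdist subr_ge0 ltrBlDl.
by have := floor_itv (repr y - repr x); rewrite intrD.
Qed.

Lemma cdist_piE a b : a <= b < a + 1 ->
  cdist (\pi_(circle R) a) (\pi_(circle R) b) = b - a.
Proof.
move=> ab; rewrite cdist_pi (_ : Num.floor _ = 0) ?subr0//.
by apply: floor_def; rewrite add0r; lra.
Qed.

Lemma cdistxx x : cdist x x = 0.
Proof. by rewrite /cdist subrr floor0 subr0. Qed.

Lemma pi_cdist a y : \pi_(circle R) (a + cdist (\pi_(circle R) a) y) = y.
Proof.
rewrite -[in LHS](reprK y) cdist_pi addrA subrKC -intrN pi_circleD.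
exact: reprK.
Qed.

Lemma cdist_inj x : injective (cdist x).
Proof.
move=> y y' xyy'; have E := pi_cdist (repr x); rewrite reprK in E.
by rewrite -(E y) xyy' E.
Qed.

(** The representative in [0, 1), whereas [repr] picks an arbitrary one. *)
Definition coord x : R := cdist (\pi_(circle R) 0) x.

Lemma pi_coord x : \pi_(circle R) (coord x) = x.
Proof. by rewrite -[RHS](pi_cdist 0) add0r. Qed.

Lemma coord_itv x : 0 <= coord x < 1. Proof. exact: cdist_itv. Qed.

(** The correction is a full turn, due when the arc from x to y crosses the origin. In this form,
    measurability of the distance reduces to that of [coord]. *)
Lemma cdist_coord x y : cdist x y = coord y - coord x + (coord y < coord x)%R%:R.
Proof.
have := coord_itv x; have := coord_itv y.
rewrite -{3}(pi_coord x) -{3}(pi_coord y); move: (coord x) (coord y) => a b.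
case: (ltP b a) => ba b01 a01; last by rewrite cdist_piE ?addr0//; lra.
by rewrite -(pi_circleD b 1) cdist_piE ?mulr1n; lra.
Qed.

End circle_coordinates.

(** * The map f_r and the lifts of its orbits *)

Section furthest.
Context {R : realType} {r : R} {X : {fset circle R}}.
Implicit Types x y : X.
Local Notation f := (furthest r (X := X)).

Lemma furthestP x : 0 < r -> cdist (val x) (val (f x)) < r /\
  forall y, cdist (val x) (val y) < r ->
    cdist (val x) (val y) <= cdist (val x) (val (f x)).
Proof.
move=> r_gt0; rewrite /furthest; case: arg_maxP => //=.
by rewrite unfold_in/= cdistxx.
Qed.

(** Eliminates the arg max in favour of comparisons of distances, whose measurability is accessible.
    Uniqueness comes from the injectivity of the distance from x. *)
Lemma furthest_eq x y : 0 < r -> f x = y <-> (cdist (val x) (val y) < r /\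
  forall y', cdist (val x) (val y') < r ->
    cdist (val x) (val y') <= cdist (val x) (val y)).
Proof.
move=> r_gt0; split=> [<-|[y_lt y_max]]; first exact: furthestP.
have [f_lt f_max] := furthestP x r_gt0.
by apply/val_inj/(@cdist_inj _ (val x))/le_anti; rewrite y_max// f_max.
Qed.

(** Since the orbit closes up, rotating the trajectory of x by one gives the trajectory of [f x]. *)
Lemma winding_number_traject x l : (0 < l)%N -> iter l f x = x ->
  winding_number [seq val y | y <- traject f x l] =
  \sum_(0 <= i < l) cdist (val (iter i f x)) (val (iter i.+1 f x)).
Proof.
have sum_zip n y : \sum_(uv <- zip [seq val u | u <- traject f y n]
      [seq val u | u <- traject f (f y) n]) cdist uv.1 uv.2 =
    \sum_(0 <= i < n) cdist (val (iter i f y)) (val (iter i.+1 f y)).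
  elim: n y => [|n IHn] y; first by rewrite big_nil big_geq.
  rewrite /= big_cons IHn big_nat_recl//=; congr (_ + _).
  by apply: eq_bigr => i _; rewrite -!iterSr.
case: l => // l _ xl; rewrite /winding_number -map_rot -sum_zip.
have -> // : rot 1 (traject f x l.+1) = traject f (f x) l.+1.
by rewrite [in LHS]trajectS rot1_cons trajectSr -iterSr xl.
Qed.

Definition orbit_lift x (m : nat) : R :=
  coord (val x) + \sum_(0 <= i < m) cdist (val (iter i f x)) (val (iter i.+1 f x)).

Lemma orbit_lift0 x : orbit_lift x 0 = coord (val x).
Proof. by rewrite /orbit_lift big_geq ?addr0. Qed.

Lemma orbit_liftS x m :
  orbit_lift x m.+1 = orbit_lift x m + cdist (val (iter m f x)) (val (iter m.+1 f x)).
Proof. by rewrite /orbit_lift big_nat_recr//= addrA. Qed.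

Lemma pi_lift x m : (\pi_(circle R) (orbit_lift x m) = val (iter m f x))%qT.
Proof.
elim: m => [|m IHm]; first by rewrite orbit_lift0 pi_coord.
by rewrite orbit_liftS -IHm pi_cdist.
Qed.

Lemma orbit_lift_winding x l : (0 < l)%N -> iter l f x = x ->
  orbit_lift x l - orbit_lift x 0 = winding_number [seq val y | y <- traject f x l].
Proof. by move=> l_gt0 xl; rewrite winding_number_traject// orbit_lift0 addrC addKr. Qed.

Lemma orbit_lift_periodic x l m : iter l f x = x ->
  orbit_lift x (m + l) = orbit_lift x m + (orbit_lift x l - orbit_lift x 0).
Proof.
move=> xl; elim: m => [|m IHm]; first by rewrite add0n subrKC.
by rewrite addSn !orbit_liftS IHm -addSn !iterD xl; ring.
Qed.

Lemma orbit_lift_max x m b : 0 < r <= 1 -> ((\pi_(circle R) b)%qT \in X) ->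
  b < orbit_lift x m + r -> b <= orbit_lift x m.+1.
Proof.
move=> /andP[r_gt0 r1] bX b_lt; rewrite orbit_liftS.
have [f_lt f_max] := furthestP (iter m f x) r_gt0.
have [/ltW b_le|orbit_lift_le] := ltP b (orbit_lift x m).
  apply: le_trans b_le _; rewrite lerDl.
  by have /andP[] := cdist_itv (val (iter m f x)) (val (iter m.+1 f x)).
rewrite -lerBlDl.
(* Here r <= 1 matters: b is less than a full turn ahead, so the distance on the circle is the real
   difference. *)
have bE : cdist (val (iter m f x)) (\pi_(circle R) b)%qT = b - orbit_lift x m.
  by rewrite -pi_lift cdist_piE//; lra.
by have := f_max [` bX]%fset; rewrite /= bE; apply; lra.
Qed.

(** [X] is finite, so r - d(y, f y) attains a positive minimum; this uniform loss makes the rotating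
    frame descend without bound. *)
Lemma orbit_lift_gap x : 0 < r ->
  exists2 eps, 0 < eps & forall m, orbit_lift x m.+1 <= orbit_lift x m + r - eps.
Proof.
move=> r_gt0.
have [y _ y_min] := @arg_minP _ _ _ x xpredT
  (fun y => r - cdist (val y) (val (f y))) isT.
exists (r - cdist (val y) (val (f y))).
  by rewrite subr_gt0; have [] := furthestP y r_gt0.
by move=> m; rewrite orbit_liftS; have := y_min (iter m f x) isT; rewrite /=; lra.
Qed.

End furthest.

(** Reachability between periodic points replaces equality of orbits as sets; this form suits both
    the window argument and measurability. *)
Lemma single_periodic_orbitP {T : Type} (f : T -> T) : single_periodic_orbit f <->
  (exists x, Defs.periodic f x) /\
  forall x y, Defs.periodic f x -> Defs.periodic f y -> exists m, iter m f x = y.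
Proof.
split=> [[A [[x xP xA] A_uniq]]|[[x xP] reach]].
  split=> [|y y' yP yP']; first by exists x.
  have : forward_orbit f y y'.
    rewrite -(A_uniq (forward_orbit f y)); last by exists y.
    by rewrite (A_uniq (forward_orbit f y')); [exists 0|exists y'].
  by case=> m _ mE; exists m.
exists (forward_orbit f x); split; first by exists x.
move=> _ [y yP ->]; have [a aE] := reach _ _ xP yP; have [b bE] := reach _ _ yP xP.
apply/seteqP; split=> _ [m _ <-].
  by exists (m + b)%N => //; rewrite iterD bE.
by exists (m + a)%N => //; rewrite iterD aE.
Qed.

(** * Periodic orbits in the presence of a good window *)

Section window_orbit.
Context {R : realType} {p q : nat} {X : {fset circle R}} {z : nat -> R}.
Let r : R := p%:R / q%:R.
Local Notation f := (furthest r (X := X)).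
Hypotheses (q_gt0 : (0 < q)%N) (pq : coprime p q) (r01 : 0 < r <= 1).
Hypothesis z_decr : forall j, (j.+1 < q)%N -> z j.+1 < z j.
Hypothesis X_window : forall j (e : int), (j < q)%N ->
  (q %| e - j%:Z * p%:Z)%Z -> (\pi_(circle R) (z j + e%:~R / q%:R))%qT \in X.
Hypothesis window_only : forall y (e : int), z q.-1 <= y <= z 0 ->
  (\pi_(circle R) (y + e%:~R / q%:R))%qT \in X ->
  exists2 j, (j < q)%N & y = z j /\ (q %| e - j%:Z * p%:Z)%Z.

(** The last point of the window, through which every trajectory is shown to pass. *)
Let x0_in : (\pi_(circle R) (z q.-1 + (q.-1%:Z * p%:Z)%:~R / q%:R))%qT \in X.
Proof. by apply: X_window; rewrite ?prednK// subrr dvdz0. Qed.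
Let x0 : X := [` x0_in]%fset.

Lemma orbit_window (x : X) (c : int) :
    z 0 + c%:~R / q%:R < orbit_lift (r := r) x 0 ->
  exists m, orbit_lift (r := r) x m = z q.-1 + (c + m%:Z * p%:Z)%:~R / q%:R /\
    iter m f x = x0.
Proof.
move=> c_lt; have [r_gt0 _] := andP r01.
have [eps eps_gt0 gap] := orbit_lift_gap x r_gt0.
have [||m [mE cE]] := @window_hit R p q [set b | (\pi_(circle R) b)%qT \in X] z
  q_gt0 pq z_decr X_window window_only
  (orbit_lift (r := r) x) eps eps_gt0 _ gap _ c c_lt.
- by move=> m /=; rewrite pi_lift; exact: fsvalP.
- by move=> m b /= bX; exact: orbit_lift_max.
exists m; split=> //; apply: val_inj => /=; rewrite -pi_lift mE.
have /dvdzP[k kE] := cE; rewrite -(subrK (q.-1%:Z * p%:Z) (c + _)) kE.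
rewrite [in LHS]intrD intrM mulrDl mulfK ?pnatr_eq0 -?lt0n// addrCA addrC.
exact: pi_circleD.
Qed.

Lemma window_level (y : R) : exists c : int, z 0 + c%:~R / q%:R < y.
Proof.
exists (Num.floor ((y - z 0) * q%:R) - 1); rewrite -ltrBrDl.
rewrite ltr_pdivrMr ?ltr0n// intrD; have := floor_itv ((y - z 0) * q%:R); lra.
Qed.

Lemma window_orbit_mem (x : X) : exists m, iter m f x = x0.
Proof.
have [c c_lt] := window_level (orbit_lift (r := r) x 0).
by have [m [_ mE]] := orbit_window _ _ c_lt; exists m.
Qed.

Lemma window_single_orbit : single_periodic_orbit f.
Proof.
apply/single_periodic_orbitP; split.
  exists x0; have [m mE] := window_orbit_mem (f x0).
  by exists m.+1 => //; rewrite iterSr.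
move=> x y _ [l l_gt0 yl]; have [m mE] := window_orbit_mem x.
have [k kE] := window_orbit_mem y.
have ylE t : iter (t * l) f y = y by elim: t => // t IHt; rewrite mulSn iterD IHt.
(* x reaches [x0] in m steps; y reaches it in k steps, and k l - k further steps complete k rounds
   of length l from y. *)
exists (k * l - k + m)%N; rewrite iterD mE -kE -iterD subnK ?leq_pmulr//.
Qed.

(** Visits to [x0] at the levels c and c - 1 lower u by 1 / q and are t l steps apart, while each
    period lowers u by (l p - W q) / q with W the winding number. Hence t (l p - W q) = 1 in the
    integers, and t = 1. *)
Lemma window_orbit_winding (x : X) (l : nat) : orbit_length f x l ->
  l%:R * p%:R - winding_number [seq val y | y <- traject f x l] * q%:R = 1.
Proof.
move=> [l_gt0 xl l_min]; have [r_gt0 _] := andP r01.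
rewrite -orbit_lift_winding//; set w := orbit_lift x l - orbit_lift x 0.
have q0 : q%:R != 0 :> R by rewrite pnatr_eq0 -lt0n.
have /eq_pi_circle/intrP[W wW] : (\pi_(circle R) (orbit_lift (r := r) x 0) =
    \pi_(circle R) (orbit_lift (r := r) x l))%qT by rewrite !pi_lift xl.
have [c c_lt] := window_level (orbit_lift (r := r) x 0).
have [m1 [m1E xm1]] := orbit_window _ _ c_lt.
have [|m2 [m2E xm2]] := @orbit_window x (c - 1).
  apply: le_lt_trans c_lt; rewrite lerD2l ler_pM2r ?invr_gt0 ?ltr0n//.
  by rewrite ler_int gerBl.
pose u m := orbit_lift (r := r) x m - m%:R * r.
have um1 : u m1 = z q.-1 + c%:~R / q%:R by rewrite /u m1E /r intrD intrM; field.
have um2 : u m2 = u m1 - q%:R^-1 by rewrite um1 /u m2E /r !intrD intrM; field.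
have u_anti m n : u (m + n)%N <= u m.
  elim: n => [|n IHn]; first by rewrite addn0.
  apply: le_trans IHn; rewrite addnS /u orbit_liftS -natr1.
  by have [] := furthestP (iter (m + n) f x) r_gt0; rewrite /=; lra.
have m12 : (m1 <= m2)%N.
  rewrite leqNgt; apply/negP => /ltnW/subnKC m21; have := u_anti m2 (m1 - m2)%N.
  have : 0 < q%:R^-1 :> R by rewrite invr_gt0 ltr0n.
  by rewrite m21 um2; move: (u m1) => ?; lra.
have xlE t : iter (t * l) f x = x by elim: t => // t IHt; rewrite mulSn iterD IHt.
(* Both m1 and m2 steps lead from x to [x0], and m1 l - m1 further steps lead back to x; subtracting
   m1 full periods leaves m2 - m1. *)
have xm : iter (m2 - m1) f x = x.
  rewrite -[in LHS](xlE m1) -iterD.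
  have -> : (m2 - m1 + m1 * l = m1 * l - m1 + m2)%N.
    by rewrite addnC addnBA// addnBAC// leq_pmulr.
  by rewrite iterD xm2 -xm1 -iterD subnK ?leq_pmulr// xlE.
have /dvdnP[t tE] : (l %| m2 - m1)%N.
  apply: contraT; rewrite /dvdn -lt0n => d_gt0.
  have /(l_min _ d_gt0) : iter ((m2 - m1) %% l) f x = x.
    by rewrite -[RHS]xm [in RHS](divn_eq (m2 - m1) l) addnC iterD xlE.
  by rewrite leqNgt ltn_mod l_gt0.
have orbit_lift_t s : orbit_lift (r := r) x (m1 + s * l) =
    orbit_lift (r := r) x m1 + s%:R * w.
  elim: s => [|s IHs]; first by rewrite addn0 mul0r addr0.
  rewrite mulSn addnCA addnC orbit_lift_periodic// IHs -/w -natr1; ring.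
move: um2; rewrite /u -(subnKC m12) tE orbit_lift_t natrD natrM => um2.
have tK : t%:Z * (l%:Z * p%:Z - W * q%:Z) = 1.
  apply: (@intr_inj R); rewrite !(intrM, intrD, intrN) -wW.
  have E : (t%:R * (l%:R * r - w)) * q%:R = 1.
    by rewrite (_ : t%:R * _ = q%:R^-1) ?mulVf//; move: um2; lra.
  by rewrite -[RHS]E /r -!pmulrn -/w; field.
have K1 : l%:Z * p%:Z - W * q%:Z = 1.
  have /eqP := congr1 absz tK; rewrite abszM muln_eq1 => /andP[/eqP t1 _].
  by rewrite -[RHS]tK -[t%:Z]/((absz t)%:Z) t1 mul1r.
by have := congr1 (intmul (1 : R)) K1; rewrite intrD intrN !intrM /w wW.
Qed.

End window_orbit.

(* The cell c.2, out of L, in the sector c.1, out of q. *)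
Definition in_cell {R : realType} {q L : nat} (c : 'I_q * 'I_L) : set (circle R) :=
  coord @^-1` `[(c.1 * L + c.2)%:R / (q * L)%:R,
               (c.1 * L + c.2).+1%:R / (q * L)%:R[.

(** The real position inside the sector, [y i], is ordered as the cell index [pos c i] when the
    latter are distinct. So the cells alone determine the ranks, and [z] lists the real positions of
    the points of window [k]. *)
Lemma good_window_points {R : realType} {n q L p k : nat} (q_gt0 : (0 < q)%N)
    (u : 'I_n -> circle R) (X : {fset circle R}) (c : {ffun 'I_n -> 'I_q * 'I_L}) :
  (forall x, reflect (exists i, u i = x) (x \in X)) ->
  (forall i, in_cell (c i) (u i)) -> injective (pos c) ->
  (k < n %/ q)%N -> good_window (p := p) q_gt0 c k ->
  exists z : nat -> R, [/\ forall j, (j.+1 < q)%N -> z j.+1 < z j,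
    forall j (e : int), (j < q)%N -> (q %| e - j%:Z * p%:Z)%Z ->
      (\pi_(circle R) (z j + e%:~R / q%:R))%qT \in X &
    forall y (e : int), z q.-1 <= y <= z 0 ->
      (\pi_(circle R) (y + e%:~R / q%:R))%qT \in X ->
      exists2 j, (j < q)%N & y = z j /\ (q %| e - j%:Z * p%:Z)%Z].
Proof.
move=> uX uc s_inj kn /forallP good.
have L_gt0 (i : 'I_n) : (0 < L)%N by exact: leq_ltn_trans (leq0n _) (ltn_ord (c i).2).
have q0 : q%:R != 0 :> R by rewrite pnatr_eq0 -lt0n.
pose y i : R := coord (u i) - (c i).1%:R / q%:R.
have y_itv i : (pos c i)%:R / (q * L)%:R <= y i < (pos c i).+1%:R / (q * L)%:R.
  have := uc i; rewrite /in_cell/= in_itv/= /y -[(c i).2]/(pos c i).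
  have L0 : L%:R != 0 :> R by rewrite pnatr_eq0 -lt0n (L_gt0 i).
  have E (a b : nat) : (a * L + b)%:R / (q * L)%:R = a%:R / q%:R + b%:R / (q * L)%:R :> R.
    by rewrite natrD !natrM; field; rewrite q0 L0.
  by rewrite -addnS !E => uci; rewrite lerBrDl ltrBlDl.
have y_lt i j : (pos c i < pos c j)%N -> y i < y j.
  move=> ij; have /andP[_ /lt_le_trans->//] := y_itv i.
  have /andP[+ _] := y_itv j; apply: le_trans.
  by rewrite ler_wpM2r ?invr_ge0// ler_nat.
have {L_gt0} y_q i : 0 <= y i < q%:R^-1.
  have /andP[lo hi] := y_itv i; rewrite (le_trans _ lo) ?divr_ge0//=.
  apply: lt_le_trans hi _; rewrite ler_pdivrMr ?ltr0n ?muln_gt0 ?q_gt0 ?(L_gt0 i)//.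
  by rewrite natrM mulKf// ler_nat.
have rank_lt i j : (desc_rank (pos c) i < desc_rank (pos c) j)%N -> (pos c j < pos c i)%N.
  move=> ij; case: ltngtP => // [/desc_rank_anti/(ltn_trans ij)|/val_inj/s_inj ij'].
    by rewrite ltnn.
  by rewrite ij' ltnn in ij.
(* The default 0 does not occur for j < q: as k < n / q, the rank k q + j is below n and some point
   has it. *)
pose z j := if [pick i | desc_rank (pos c) i == k * q + j]%N is Some i then y i else 0.
have zE i j : desc_rank (pos c) i = (k * q + j)%N -> z j = y i.
  move=> ij; rewrite /z; case: pickP => [i' /eqP|/(_ i)]; last by rewrite ij eqxx.
  by rewrite -ij => /(desc_rank_inj _ s_inj)->.
have idx j : (j < q)%N -> exists2 i, desc_rank (pos c) i = (k * q + j)%N & z j = y i.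
  move=> jq; have [|i iE] := desc_rank_surj _ (k * q + j) s_inj.
    apply: leq_trans (leq_trunc_div n q); apply: (@leq_trans (k.+1 * q)).
      by rewrite mulSn addnC ltn_add2r.
    by rewrite leq_mul2r kn orbT.
  by exists i => //; exact: zE.
have color i j : (j < q)%N -> desc_rank (pos c) i = (k * q + j)%N ->
    (c i).1 = (j * p %% q)%N :> nat.
  move=> jq ij; have := good i.
  by rewrite ij divnMDl// divn_small// addn0 eqxx modnMDl modn_small//= => /eqP->.
have color_dvd (e : int) i j : (j < q)%N -> desc_rank (pos c) i = (k * q + j)%N ->
    (q %| e - (c i).1%:Z)%Z = (q %| e - j%:Z * p%:Z)%Z.
  move=> jq /(color _ _ jq)->; rewrite -!eqz_mod_dvd -PoszM.
  by rewrite -modz_nat modz_mod.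
exists z; split=> [j jq|j e jq je|v e v_itv].
- have [i iE ->] := idx _ (ltnW jq); have [i' iE' ->] := idx _ jq.
  by apply/y_lt/rank_lt; rewrite iE iE' ltn_add2l.
- have [i iE ->] := idx _ jq; move: je; rewrite -(color_dvd _ _ _ jq iE).
  move=> /dvdzP[m mE]; apply/uX; exists i.
  rewrite -[LHS]pi_coord -(pi_circleD _ m); congr (\pi_(circle R) _)%qT.
  rewrite /y -(subrK (c i).1%:Z e) mE intrD intrM -!pmulrn; field.
  by [].
move=> /uX[i]; rewrite -[u i]pi_coord => /esym/eq_pi_circle/intrP[m mE].
have [i0 i0E z0] := idx 0 q_gt0.
have [i1 i1E z1] : exists2 i, desc_rank (pos c) i = (k * q + q.-1)%N & z q.-1 = y i.
  by apply: idx; rewrite prednK.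
rewrite z0 z1 in v_itv.
(* Both [y i] and [v] lie in [0, 1 / q) and differ by N / q, so the integer N vanishes. *)
pose N := m * q%:Z + e - (c i).1%:Z.
have NE : y i - v = N%:~R / q%:R.
  have -> : y i = v + e%:~R / q%:R + m%:~R - (c i).1%:R / q%:R.
    by rewrite /y -mE; ring.
  rewrite /N intrD intrN intrD intrM -!pmulrn; field.
  by [].
have N0 : N = 0.
  have : - q%:R^-1 < (N%:~R / q%:R : R) < q%:R^-1.
    by rewrite -NE; have := y_q i; have := y_q i0; have := y_q i1; lra.
  rewrite ltr_pdivrMr ?ltr0n// mulVf// ltr_pdivlMr ?ltr0n// mulNr mulVf//.
  by rewrite (ltr_int R (-1)) (ltr_int R _ 1); lia.
have vi : v = y i.
  by apply/esym/eqP; rewrite -subr_eq0 NE N0 mul0r.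
have ri1 : (desc_rank (pos c) i <= k * q + q.-1)%N.
  rewrite -i1E leqNgt; apply/negP => /rank_lt/y_lt; rewrite -vi ltNge.
  by case/andP: v_itv => ->.
have ri0 : (k * q <= desc_rank (pos c) i)%N.
  rewrite -[(k * q)%N]addn0 -i0E leqNgt; apply/negP => /rank_lt/y_lt; rewrite -vi ltNge.
  by case/andP: v_itv => _ ->.
have rE : desc_rank (pos c) i = (k * q + (desc_rank (pos c) i - k * q))%N.
  by rewrite subnKC.
have jq : (desc_rank (pos c) i - k * q < q)%N.
  by rewrite ltn_subLR// (leq_ltn_trans ri1)// ltn_add2l ltn_predL.
exists (desc_rank (pos c) i - k * q)%N => //; split.
  by rewrite vi; exact/esym/zE.
rewrite -(color_dvd _ _ _ jq rE); apply/dvdzP; exists (- m).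
by move: N0; rewrite /N => ?; lia.
Qed.

(** * Measurability of the event *)

Section measurable_logic.
Context {d : measure_display} {T : measurableType d}.

Lemma measurable_exists (I : countType) (A : I -> T -> Prop) :
  (forall i, measurable [set w | A i w]) -> measurable [set w | exists i, A i w].
Proof.
move=> mA; rewrite (_ : [set w | _] = \bigcup_i [set w | A i w]).
  exact: countable_bigcupT_measurable.
by apply/seteqP; split=> [w [i Aiw]|w [i _ Aiw]]; exists i.
Qed.

Lemma measurable_not (A : T -> Prop) :
  measurable [set w | A w] -> measurable [set w | ~ A w].
Proof. exact: measurableC. Qed.

Lemma measurable_forall (I : countType) (A : I -> T -> Prop) :
  (forall i, measurable [set w | A i w]) -> measurable [set w | forall i, A i w].
Proof.
move=> mA; rewrite (_ : [set w | _] = ~` [set w | exists i, ~ A i w]).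
  by apply/measurableC/measurable_exists => i; exact: measurable_not.
by rewrite -[LHS]setCK; congr (~` _); apply/seteqP; split=> w /existsNP.
Qed.

Lemma measurable_imply (A B : T -> Prop) : measurable [set w | A w] ->
  measurable [set w | B w] -> measurable [set w | A w -> B w].
Proof.
move=> mA mB; rewrite (_ : [set w | _] = ~` [set w | A w] `|` [set w | B w]).
  by apply: measurableU => //; exact: measurableC.
by apply/seteqP; split=> w; rewrite /= -implyE.
Qed.

Lemma measurable_pred (b : T -> bool) :
  measurable_fun setT b -> measurable [set w | b w].
Proof. by move=> /(_ measurableT [set true]); rewrite setTI; exact. Qed.

End measurable_logic.

(** [coord] jumps at the origin but is lower semicontinuous: for a >= 0 the preimage of the ray
    above a lifts to the union of the open intervals from a + m to 1 + m, which is open. *)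
Lemma measurable_coord (R : realType) : measurable_fun setT (@coord R).
Proof.
apply: (@measurability _ _ (circle R) R setT (@coord R) (@RGenOInfty.G R)).
  exact: RGenOInfty.measurableE.
move=> _ [_ [a ->] <-]; rewrite setTI.
have [a_lt0|a_ge0] := ltP a 0.
  rewrite (_ : _ @^-1` _ = setT)//; apply/seteqP; split=> // x _ /=.
  by rewrite in_itv/= andbT; have /andP[/(lt_le_trans a_lt0)] := coord_itv x.
apply: sub_sigma_algebra.
pose A : set R := \bigcup_(m : int) `]a + m%:~R, 1 + m%:~R[%classic.
suff : open (\pi_(circle R)%qT @^-1` (@coord R @^-1` `]a, +oo[) : set R) by [].
rewrite (_ : _ @^-1` _ = A); first by apply: bigcup_open => m _; exact: interval_open.
apply/seteqP; split=> [v|v [m _]] /=; rewrite !in_itv/= ?andbT.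
  move=> av; exists (Num.floor v) => //=.
  rewrite in_itv/=; move: av; rewrite /coord cdist_pi subr0 => av.
  by have := floor_itv v; rewrite intrD; lra.
move=> /andP[av v1]; rewrite /coord -(subrK m%:~R v) pi_circleD cdist_piE; lra.
Qed.

Section measurable_orbits.
Context {d : measure_display} {T : measurableType d} {R : realType} {r : R}.
Context {P : probability T R} {n : nat} {U : 'I_n -> {RV P >-> circle R}}.
Hypothesis r_gt0 : 0 < r.
Local Notation X := (random_points U).
Local Notation f w := (furthest r (X := X w)).

Lemma random_pointsP w x : reflect (exists i, U i w = x) (x \in X w).
Proof.
rewrite /random_points; apply: (iffP (imfsetP _ _ _ _)) => /= [[i _ ->]|[i <-]].
  by exists i.
by exists i.
Qed.

Lemma random_point_in i w : U i w \in X w.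
Proof. by apply/random_pointsP; exists i. Qed.

(** The type [X w] varies with w; naming its elements by fixed indices turns quantifiers over [X w]
    into finite ones independent of w. *)
Definition random_point i w : X w := [` random_point_in i w]%fset.

Lemma random_point_surj w (x : X w) : exists i, random_point i w = x.
Proof.
have /random_pointsP[i ix] := fsvalP x.
by exists i; exact: val_inj.
Qed.

Lemma measurable_cdist i j : measurable_fun setT (fun w => cdist (U i w) (U j w)).
Proof.
have mU k : measurable_fun setT (coord \o U k).
  by apply: measurableT_comp (measurable_funPT (U k)); exact: measurable_coord.
under eq_fun do rewrite cdist_coord.
apply: measurable_funD; first by apply: measurable_funB; exact: mU.
rewrite (_ : (fun w => _) =
  (fun w => if coord (U j w) < coord (U i w) then 1 else 0 : R)); last first.
  by apply/funext => w; case: ifP.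
by apply: measurable_fun_ifT => //; apply: measurable_fun_ltr; exact: mU.
Qed.

(** Induction on m, splitting on the index k of the m-th iterate and describing the last step by
    comparisons of distances. *)
Lemma measurable_iter_furthest m i j :
  measurable [set w | iter m (f w) (random_point i w) = random_point j w].
Proof.
elim: m j => [|m IHm] j.
  rewrite (_ : [set w | _] = [set w | cdist (U i w) (U j w) == 0]).
    by apply/measurable_pred/measurable_fun_eqr => //; exact: measurable_cdist.
  apply/seteqP; split=> w /= [ij].
    by rewrite ij cdistxx.
  apply/val_inj/(@cdist_inj _ (U i w)) => /=.
  by rewrite cdistxx (eqP ij).
rewrite (_ : [set w | _] = [set w | exists k,
    iter m (f w) (random_point i w) = random_point k w /\
    (cdist (U k w) (U j w) < r /\ forall l, cdist (U k w) (U l w) < r ->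
      cdist (U k w) (U l w) <= cdist (U k w) (U j w))]).
  apply: measurable_exists => k; apply: measurableI; first exact: IHm.
  apply: measurableI.
    by apply/measurable_pred/measurable_fun_ltr => //; exact: measurable_cdist.
  apply: measurable_forall => l; apply: measurable_imply.
    by apply/measurable_pred/measurable_fun_ltr => //; exact: measurable_cdist.
  by apply/measurable_pred/measurable_fun_ler; exact: measurable_cdist.
apply/seteqP; split=> w /=.
  move=> /(furthest_eq _ _ r_gt0)[lt_r max_r].
  have [k kE] := random_point_surj _ (iter m (f w) (random_point i w)).
  exists k; split=> //; rewrite -kE in lt_r max_r; split=> // l.
  exact: (max_r (random_point l w)).
move=> [k [-> [lt_r max_r]]]; apply/(furthest_eq _ _ r_gt0); split=> // y.
by have [l <-] := random_point_surj _ y; exact: max_r.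
Qed.

(** The preimage splits into finitely many pieces according to the indices of the two successive
    iterates. *)
Lemma measurable_iter_cdist m i : measurable_fun setT (fun w =>
  cdist (val (iter m (f w) (random_point i w)))
    (val (iter m.+1 (f w) (random_point i w)))).
Proof.
move=> _ B mB; rewrite setTI.
rewrite (_ : _ @^-1` _ = [set w | exists j, exists k,
    [/\ iter m (f w) (random_point i w) = random_point j w,
    iter m.+1 (f w) (random_point i w) = random_point k w &
    B (cdist (U j w) (U k w))]]).
  apply: measurable_exists => j; apply: measurable_exists => k.
  rewrite (_ : [set w | _] =
    [set w | iter m (f w) (random_point i w) = random_point j w] `&`
    ([set w | iter m.+1 (f w) (random_point i w) = random_point k w] `&`
    (fun w => cdist (U j w) (U k w)) @^-1` B)).
    apply: measurableI; first exact: measurable_iter_furthest.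
    apply: measurableI; first exact: measurable_iter_furthest.
    by rewrite -[X in measurable X]setTI; exact: measurable_cdist.
  by apply/seteqP; split=> w /=; [case | case=> ? []].
apply/seteqP; split=> w /=; last by move=> [j [k [-> -> //]]].
have [j jE] := random_point_surj _ (iter m (f w) (random_point i w)).
have [k kE] := random_point_surj _ (iter m.+1 (f w) (random_point i w)).
move=> Bw; exists j, k; split=> //.
by rewrite -[U j w]/(val (random_point j w)) jE -[U k w]/(val (random_point k w)) kE.
Qed.

Lemma measurable_periodic i : measurable [set w | Defs.periodic (f w) (random_point i w)].
Proof.
rewrite (_ : [set w | _] = [set w | exists m : nat, (1 <= m)%N /\
    iter m (f w) (random_point i w) = random_point i w]).
  apply: measurable_exists => m; apply: measurableI; last exact: measurable_iter_furthest.
  exact: measurable_pred.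
by apply/seteqP; split=> w [m]; [exists m|move=> []; exists m].
Qed.

Lemma measurable_single_periodic_orbit : measurable [set w | single_periodic_orbit (f w)].
Proof.
rewrite (_ : [set w | _] = [set w |
    (exists i, Defs.periodic (f w) (random_point i w)) /\
    forall i j, Defs.periodic (f w) (random_point i w) ->
      Defs.periodic (f w) (random_point j w) ->
      exists m, iter m (f w) (random_point i w) = random_point j w]).
  apply: measurableI; first by apply: measurable_exists; exact: measurable_periodic.
  apply: measurable_forall => i; apply: measurable_forall => j.
  do 2![apply: measurable_imply; first exact: measurable_periodic].
  by apply: measurable_exists => m; exact: measurable_iter_furthest.
apply/seteqP; split=> w /=.
  move=> /single_periodic_orbitP[[x xP] reach]; split=> [|i j]; last exact: reach.
  by have [i ix] := random_point_surj _ x; exists i; rewrite ix.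
move=> [[i iP] reach]; apply/single_periodic_orbitP; split=> [|x y].
  by exists (random_point i w).
have [j <-] := random_point_surj _ x; have [k <-] := random_point_surj _ y.
exact: reach.
Qed.

Lemma measurable_orbit_winding (p q : R) : measurable [set w |
  forall (x : X w) (l : nat), orbit_length (f w) x l ->
    l%:R * p - winding_number [seq val y | y <- traject (f w) x l] * q = 1].
Proof.
rewrite (_ : [set w | _] = [set w | forall i (l : nat),
    [/\ (1 <= l)%N, iter l (f w) (random_point i w) = random_point i w &
      forall m : nat, (1 <= m)%N ->
        iter m (f w) (random_point i w) = random_point i w -> (l <= m)%N] ->
    l%:R * p - \sum_(0 <= m < l) cdist (val (iter m (f w) (random_point i w)))
      (val (iter m.+1 (f w) (random_point i w))) * q = 1]).
  apply: measurable_forall => i; apply: measurable_forall => l.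
  apply: measurable_imply.
    rewrite (_ : [set w | _] = [set w | (1 <= l)%N] `&`
      ([set w | iter l (f w) (random_point i w) = random_point i w] `&`
      [set w | forall m : nat, (1 <= m)%N ->
        iter m (f w) (random_point i w) = random_point i w -> (l <= m)%N])).
      apply: measurableI; first exact: measurable_pred.
      apply: measurableI; first exact: measurable_iter_furthest.
      apply: measurable_forall => m; apply: measurable_imply; first exact: measurable_pred.
      apply: measurable_imply; first exact: measurable_iter_furthest.
      exact: measurable_pred.
    by apply/seteqP; split=> w /=; [case | case=> ? []].
  rewrite (_ : [set w | _] = [set w | l%:R * p - \sum_(0 <= m < l)
      cdist (val (iter m (f w) (random_point i w)))
      (val (iter m.+1 (f w) (random_point i w))) * q == 1]); last first.
    by apply/seteqP; split=> w /= /eqP.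
  apply/measurable_pred/measurable_fun_eqr => //; apply: measurable_funB => //.
  apply: measurable_sum => m; apply: measurable_funM => //.
  exact: measurable_iter_cdist.
apply/seteqP; split=> w /= H.
  move=> i l il; have := H _ _ il; case: il => l_gt0 il _.
  by rewrite winding_number_traject// big_distrl.
move=> x l; have [i <-] := random_point_surj _ x => il.
have := H _ _ il; case: il => l_gt0 il _.
by rewrite winding_number_traject// big_distrl.
Qed.

End measurable_orbits.

(** * Cells under the uniform law, and a union bound *)

Lemma measurable_pi_circle (R : realType) :
  measurable_fun setT (\pi_(circle R)%qT : R -> circle R).
Proof.
apply: (@measurability _ _ R (circle R) setT _ open) => // _ [B oB <-].
by rewrite setTI; exact: open_measurable.
Qed.

Lemma measurable_in_cell {R : realType} {q L : nat} (c : 'I_q * 'I_L) :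
  measurable (in_cell c : set (circle R)).
Proof. by rewrite -[X in measurable X]setTI; apply: measurable_coord. Qed.

Lemma in_cell_ex {R : realType} {q L : nat} (x : circle R) :
  (0 < q)%N -> (0 < L)%N -> exists c : 'I_q * 'I_L, in_cell c x.
Proof.
move=> q_gt0 L_gt0; have K_gt0 : (0 < q * L)%N by rewrite muln_gt0 q_gt0.
have [x0 x1] := andP (coord_itv x).
have t0 : 0 <= coord x * (q * L)%:R by rewrite mulr_ge0.
have /andP[m1 m2] := truncn_itv t0; set m := Num.truncn _ in m1 m2.
have mK : (m < q * L)%N.
  by rewrite -(ltr_nat R) (le_lt_trans m1)// gtr_pMl ?ltr0n.
have mq : (m %/ L < q)%N by rewrite ltn_divLR.
exists (Ordinal mq, Ordinal (ltn_pmod m L_gt0)).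
rewrite /in_cell/= in_itv/= -divn_eq ler_pdivrMr ?ltr0n// ltr_pdivlMr ?ltr0n//.
by rewrite m1 m2.
Qed.

(** Within [0, 1], the cell lifts into an interval of length 1 / (q L), together possibly with the
    endpoint 1, which represents the origin and has measure 0. *)
Lemma circle_uniform_in_cell {R : realType} {q L : nat} (c : 'I_q * 'I_L) :
  (circle_uniform (in_cell c : set (circle R)) <= ((q * L)%:R^-1)%:E)%E.
Proof.
set a := (c.1 * L + c.2)%N; set K := (q * L)%N.
have K_gt0 : (0 < K)%N.
  by rewrite muln_gt0 (leq_ltn_trans _ (ltn_ord c.1))// (leq_ltn_trans _ (ltn_ord c.2)).
have Kinv : 0 < K%:R^-1 :> R by rewrite invr_gt0 ltr0n.
rewrite /circle_uniform /pushforward /uniform_prob integral_uniform_pdf.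
set S := _ `&` _; pose J : set R := `[a%:R / K%:R, a.+1%:R / K%:R]%classic.
pose I : set R := J `|` [set 1].
have mJ : measurable J by exact: measurable_itv.
have mS : measurable S.
  apply: measurableI => //; rewrite -[X in measurable X]setTI.
  by apply: measurable_pi_circle => //; exact: measurable_in_cell.
rewrite (eq_integral (cst 1%E)); last first.
  by move=> v; rewrite inE => -[_]; rewrite /= in_itv/= /uniform_pdf subr0 invr1 => ->.
rewrite integral_cst// mul1e.
have SI : S `<=` I.
  move=> v [/=]; rewrite /in_cell/= !in_itv/= => vc /andP[v0].
  rewrite le_eqVlt => /orP[/eqP->|v1]; [by right|left => /=].
  move: vc; rewrite /coord cdist_piE ?subr0 ?v0 ?add0r// /J/= in_itv/= => /andP[-> /ltW->].
  by [].
apply: (@le_trans _ _ (lebesgue_measure I)).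
  apply: le_measure => //; rewrite inE//; exact: measurableU.
apply: (@le_trans _ _ (lebesgue_measure J + lebesgue_measure [set 1%R : R])%E).
  exact: measureU2.
rewrite /J lebesgue_measure_set1 adde0 lebesgue_measure_itv/= lte_fin.
rewrite ltr_pM2r// ltr_nat ltnSn.
by rewrite -EFinD -mulrBl -natrB// subSnn mul1r.
Qed.

Lemma content_finite_union_bound {d} {T : measurableType d} {R : realType}
    {P : {measure set T -> \bar R}} {I : finType} (B : {set I}) (F : I -> set T)
    (A : set T) (e : R) :
  (forall i, measurable (F i)) -> measurable A ->
  (forall w, A w -> exists2 i, i \in B & F i w) ->
  (forall i, (P (F i) <= e%:E)%E) -> (P A <= (#|B|%:R * e)%:E)%E.
Proof.
move=> mF mA AF Fe.
have AB : A `<=` \bigcup_(i in [set` mem B]) F i.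
  by move=> w /AF[i iB Fi]; exists i.
apply: (@le_trans _ _ (\sum_(i \in [set` mem B]) P (F i))%E).
  by apply: content_sub_fsum => //; exact: finite_finset.
rewrite -(@bigfs _ _ _ _ (index_enum I)) ?index_enum_uniq//; last first.
  by move=> i _; rewrite mem_index_enum.
apply: (@le_trans _ _ (\sum_(i in B) e%:E)%E); first by apply: lee_sum => i _.
by rewrite sumEFin sumr_const mulr_natl.
Qed.

Lemma cvg_divn (q : nat) : (0 < q)%N -> (n %/ q)%N @[n --> \oo] --> \oo.
Proof.
move=> q_gt0 A [m _ mA]; exists (m * q)%N => // n /= mn.
by apply: mA => /=; rewrite leq_divRL.
Qed.

(** * Lower bound for the probability of the event *)

Section random_cells.
Context {d : measure_display} {T : measurableType d} {R : realType}.
Context {P : probability T R} {n : nat} {U : 'I_n -> {RV P >-> circle R}}.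
Hypothesis U_indep : mutually_independent U.
Hypothesis U_unif : forall i (A : set (circle R)), measurable A ->
  distribution P (U i) A = circle_uniform A.

(** Written as an intersection over the full index set, the shape to which [mutually_independent]
    applies. *)
Definition cells_event {q L} (c : {ffun 'I_n -> 'I_q * 'I_L}) : set T :=
  \bigcap_(i in [set` [set: 'I_n]%SET]) (U i @^-1` in_cell (c i)).

Lemma measurable_cells_event {q L} (c : {ffun 'I_n -> 'I_q * 'I_L}) :
  measurable (cells_event c).
Proof.
apply: fin_bigcap_measurable => [|i _]; first exact: finite_finset.
rewrite -[X in measurable X]setTI; apply: measurable_funPT => //.
exact: measurable_in_cell.
Qed.

Lemma cells_event_le {q L} (c : {ffun 'I_n -> 'I_q * 'I_L}) :
  (P (cells_event c) <= ((((q * L) ^ n)%N%:R)^-1)%:E)%E.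
Proof.
rewrite /cells_event U_indep; last by move=> i; exact: measurable_in_cell.
apply: (@le_trans _ _ (\prod_(i in [set: 'I_n]%SET) ((q * L)%N%:R^-1)%:E)%E).
  (* Nonnegativity is carried along because products of extended reals are compared factor by factor
     only when nonnegative. *)
  apply: (@proj2 (0 <= \prod_(i in [set: 'I_n]%SET) P (U i @^-1` in_cell (c i)))%E).
  apply: (big_ind2 (fun a b => 0 <= a /\ a <= b)%E) => [|a b a' b' [a0 ab] [a0' ab']|i _].
  - by rewrite lee_fin ler01.
  - by split; [exact: mule_ge0|exact: lee_pmul].
  split; first exact: measure_ge0.
  rewrite -[leLHS]/(distribution P (U i) (in_cell (c i))) U_unif.
    exact: circle_uniform_in_cell.
  exact: measurable_in_cell.
by rewrite prodEFin prodr_const cardsT card_ord natrX exprVn.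
Qed.

Context {p q : nat}.
Hypotheses (q_gt0 : (0 < q)%N) (pq : coprime p q).
Let r : R := p%:R / q%:R.
Hypothesis r01 : 0 < r <= 1.

Definition unit_orbit_event (s : R) : set T := [set w |
  let X := random_points U w in
  let f : X -> X := furthest s (X := X) in
  single_periodic_orbit f /\
  forall (x : X) (l : nat), orbit_length f x l ->
    l%:R * p%:R
      - winding_number [seq val y | y <- traject f x l] * q%:R = 1].

Lemma measurable_unit_orbit_event (s : R) : 0 < s -> measurable (unit_orbit_event s).
Proof.
move=> s_gt0; apply: measurableI.
  exact: measurable_single_periodic_orbit.
exact: measurable_orbit_winding.
Qed.

(** Each colouring has probability at most (q L)^-n and only bad ones occur outside the event, so
    the complement has probability at most the proportion of bad colourings. *)
Lemma unit_orbit_event_ge (L : nat) : (0 < L)%N ->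
  ((1 - (n%:R ^+ 2 / L%:R + ((q ^ q).-1%:R / (q ^ q)%:R) ^+ (n %/ q)))%:E <=
    P (unit_orbit_event r))%E.
Proof.
move=> L_gt0; have [r_gt0 _] := andP r01.
have mE := measurable_unit_orbit_event r r_gt0.
have K_gt0 : (0 < (q * L) ^ n)%N by rewrite expn_gt0 muln_gt0 q_gt0 L_gt0.
have D_gt0 : (0 < q ^ q)%N by rewrite expn_gt0 q_gt0.
set bad := @bad_cells n q L p q_gt0.
have := @card_bad_cells n q L p q_gt0; rewrite -/bad -(ler_nat R).
move: (q ^ q)%N D_gt0 => D D_gt0; rewrite !(natrM, natrD, natrX) => bad_le.
have badP w : (~` unit_orbit_event r) w -> exists2 c, c \in bad & cells_event c w.
  (* A cell is chosen around each point; if the resulting colouring were not bad, its good window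
     would put w in the event. *)
  move=> Ew; have [g gP] := choice (fun i => in_cell_ex (U i w) q_gt0 L_gt0).
  exists [ffun i => g i]; last by move=> i _ /=; rewrite ffunE.
  rewrite inE; apply/negP => /andP[/injectiveP s_inj /existsP[k good]]; apply: Ew.
  have gP' i : in_cell ([ffun i => g i] i) (U i w) by rewrite ffunE.
  have [z [z_decr X_window z_only]] := good_window_points q_gt0 (fun i => U i w) _
    _ (random_pointsP w) gP' s_inj (ltn_ord k) good.
  split; first exact: window_single_orbit z_decr X_window z_only.
  by move=> x l; exact: window_orbit_winding z_decr X_window z_only x l.
have : (P (~` unit_orbit_event r) <=
    (#|bad|%:R * (((q * L) ^ n)%N%:R)^-1)%:E)%E.
  exact: (content_finite_union_bound _ _ _ _ measurable_cells_event
    (measurableC mE) badP cells_event_le).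
rewrite probability_setC// -(fineK (fin_num_measure P _ mE)) -EFinB !lee_fin => PE.
suff : #|bad|%:R / ((q * L) ^ n)%:R <= n%:R ^+ 2 / L%:R +
    (D.-1%:R / D%:R) ^+ (n %/ q) :> R.
  by move=> /(le_trans PE); rewrite !lerBlDl [X in _ <= X -> _]addrC.
rewrite ler_pdivrMr ?ltr0n// natrX natrM.
have L0 : 0 < L%:R :> R by rewrite ltr0n.
have D0 : 0 < D%:R :> R by rewrite ltr0n.
rewrite -(ler_pM2r (mulr_gt0 L0 (exprn_gt0 (n %/ q) D0))).
apply: le_trans bad_le _; rewrite expr_div_n le_eqVlt; apply/orP; left.
by apply/eqP; field; rewrite !lt0r_neq0 ?exprn_gt0.
Qed.

End random_cells.

(** * Passage to the limit, by squeezing between the lower bound and 1 *)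

Theorem theorem4p7 (R : realType) (p q : nat) (p_gt0 : (0 < p)%N)
    (q_gt0 : (0 < q)%N) (coprime_pq : coprime p q)
    (r : R) (rE : r = p%:R / q%:R) (r01 : 0 < r <= 1)
    (d : nat -> measure_display) (T : forall n, measurableType (d n))
    (P : forall n, probability (T n) R)
    (U : forall n, 'I_n -> {RV (P n) >-> circle R})
    (U_indep : forall n, mutually_independent (U n))
    (U_unif : forall n (i : 'I_n) (A : set (circle R)), measurable A ->
      distribution (P n) (U n i) A = circle_uniform A) :
  let E n := [set w : T n |
    let X := random_points (U n) w in
    let f : X -> X := furthest r (X := X) in
    single_periodic_orbit f /\
    forall (x : X) (l : nat), orbit_length f x l ->
      l%:R * p%:R
        - winding_number [seq val y | y <- traject f x l] * q%:R = 1] in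
  (forall n, measurable (E n)) /\ P n (E n) @[n --> \oo] --> 1%E.
Proof.
move=> E; have [r_gt0 _] := andP r01.
have mE n : measurable (E n) by exact: measurable_unit_orbit_event.
split=> //; rewrite rE in r01.
pose rho : R := (q ^ q).-1%:R / (q ^ q)%:R.
have D_gt0 : (0 < q ^ q)%N by rewrite expn_gt0 q_gt0.
apply: (@squeeze_cvge _ _ _ _
  (fun n => (1 - (n.+1%:R^-1 + rho ^+ (n %/ q)))%:E) _ (fun=> 1%E)).
- near=> n; rewrite probability_le1// andbT.
  (* With L = (n + 1)^3 the collision term n^2 / L is at most 1 / (n + 1). *)
  have Ln : (0 < n.+1 ^ 3)%N by rewrite expn_gt0.
  rewrite /E rE; apply: le_trans (unit_orbit_event_ge (U_indep n) (U_unif n)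
    q_gt0 coprime_pq r01 _ Ln).
  rewrite lee_fin lerD2l lerN2 lerD2r natrX.
  rewrite ler_pdivrMr ?exprn_gt0// exprS mulrA mulVf// mul1r.
  by rewrite ler_pM ?ler_nat.
- apply/fine_cvgP; split; first by near=> n.
  have rho1 : `|rho| < 1.
    rewrite ger0_norm ?divr_ge0// ltr_pdivrMr ?ltr0n// mul1r ltr_nat.
    by rewrite ltn_predL.
  have rho_cvg : rho ^+ (n %/ q) @[n --> \oo] --> (0 : R).
    by apply: (cvg_comp _ _ (cvg_divn _ q_gt0)); exact: cvg_expr.
  have : (1 - (n.+1%:R^-1 + rho ^+ (n %/ q))) @[n --> \oo] --> (1 - (0 + 0) : R).
    by apply: cvgB; [exact: cvg_cst | apply: cvgD => //; exact: cvg_harmonic].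
  by rewrite addr0 subr0.
exact: cvg_cst.
Unshelve. all: by end_near.
Qed.
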